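(* For any extended $\mathcal{ALCIF}b$ knowledge base $\mathcal K$, the extended $\mathcal{ALCI}b$ knowledge base $\mathrm{Ef}(\mathcal K)$ and $\mathcal K$ are equisatisfiable.
   Context: Atomic roles: role names $R$ and inverses $R^-$. Boolean role expressions: from atomic roles via $\neg,\sqcap,\sqcup$; $S\vdash U$ means $U$ is true when exactly the atomic roles in $S$ are true; $U$ restricted if $\emptyset\not\vdash U$. Interpretations: nonempty domain; $R^-$ converse, $\neg U$ complement in $(\Delta^{\mathcal I})^2$, $\sqcap,\sqcup$ intersection/union; concepts from concept names, $\top,\bot$ via $\neg,\sqcap,\sqcup$, $\exists U.C$, $\forall U.C$ ($U$ restricted), $\le n\,R.C$ ($R$ atomic), standard semantics. A concept $C$ as TBox axiom means $C^{\mathcal I}=\Delta^{\mathcal I}$. DL-safe rules $B\to H$: conjunctions of atoms $A(t)$, $R(t,u)$ ($R^-(t,u)$ standing for $R(u,t)$), $t\approx u$ over variables and individual names; satisfied if every assignment of variables to named elements $\{a^{\mathcal I}\}$ satisfying $B$ satisfies $H$ (empty body true, empty head false). An extended $\mathcal{ALCIF}b$ knowledge base is a pair $(\mathcal T,\mathcal P)$ with $\mathcal P$ a finite rule set and $\mathcal T$ a finite set of concept axioms in negation normal form in which number restrictions occur only as whole axioms $\le 1\,R.\top$ ($R$ atomic; ''functionality axioms''). Equisatisfiable: both or neither have a model. $\mathrm{parts}(\neg D)=\mathrm{parts}(D)$; $\mathrm{parts}(D\sqcap E)=\mathrm{parts}(D\sqcup E)=\mathrm{parts}(D)\cup\mathrm{parts}(E)$;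 $\mathrm{parts}(QU.D)=\{QU.D\}\cup\mathrm{parts}(D)$ for a quantifier $Q$; $\mathrm{parts}(C)=\{C\}$ otherwise. $\mathcal K^*$ is $\mathcal K$ without its functionality axioms; $\mathrm{parts}(\mathcal K^* )$ is the union of $\mathrm{parts}$ of its TBox axioms. $\mathrm{Ef}(\mathcal K)$ is obtained from $\mathcal K$ by removing every functionality axiom $\le 1\,R.\top$ and, for each such $R$, adding: $\forall R.\neg D\sqcup\forall R.D$ for every $D\in\mathrm{parts}(\mathcal K^* )$; $\forall(R\sqcap S).\bot\sqcup\forall(R\sqcap\neg S).\bot$ for every atomic role $S$ over a role name occurring in $\mathcal K$; and the rule $R(x,y)\wedge R(x,z)\to y\approx z$. *)

(* Defs.v *)
From Stdlib Require List.
From mathcomp Require Import all_boot.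
From mathcomp Require Import boolp classical_sets functions cardinality.

Set Implicit Arguments.
Unset Printing Implicit Defensive.

Local Open Scope classical_set_scope.
Local Open Scope card_scope.

(* Throughout, [NC], [NR] and [NI] are the types of concept names, role names
   and individual names. *)

Inductive arole (NR : Type) : Type :=
| Dir of NR
| Inv of NR.

Inductive brole (NR : Type) : Type :=
| RAt of arole NR
| RNot of brole NR
| RAnd of brole NR & brole NR
| ROr of brole NR & brole NR.

Inductive concept (NC NR : Type) : Type :=
| CName of NC
| Top
| Bot
| CNot of concept NC NR
| CAnd of concept NC NR & concept NC NR
| COr of concept NC NR & concept NC NR
| Ex of brole NR & concept NC NR
| All of brole NR & concept NC NR
| AtMost of nat & arole NR & concept NC NR.

Arguments CName {NC NR} _.
Arguments Top {NC NR}.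
Arguments Bot {NC NR}.

Inductive term (NI : Type) : Type :=
| Var of nat
| Ind of NI.

Arguments Var {NI} _.

Inductive atom (NC NR NI : Type) : Type :=
| ConceptAtom of NC & term NI
| RoleAtom of NR & term NI & term NI
| EqAtom of term NI & term NI.

Arguments ConceptAtom {NC NR NI} _ _.
Arguments RoleAtom {NC NR NI} _ _ _.
Arguments EqAtom {NC NR NI} _ _.

(* R^-(t,u) is only an abbreviation for R(u,t). *)
Definition arole_atom (NC NR NI : Type) (r : arole NR) (t u : term NI) :
    atom NC NR NI :=
  match r with
  | Dir R => RoleAtom R t u
  | Inv R => RoleAtom R u t
  end.

Record rule (NC NR NI : Type) : Type := Rule {
  body : seq (atom NC NR NI);
  head : seq (atom NC NR NI)
}.

Record kb (NC NR NI : Type) : Type := KB {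
  tbox : seq (concept NC NR);
  rbox : seq (rule NC NR NI)
}.

Fixpoint entails (NR : Type) (S : pred (arole NR)) (U : brole NR) : bool :=
  match U with
  | RAt r => S r
  | RNot V => ~~ entails S V
  | RAnd V W => entails S V && entails S W
  | ROr V W => entails S V || entails S W
  end.

Definition restricted (NR : Type) (U : brole NR) : bool := ~~ entails pred0 U.

(* Side condition of the concept grammar: quantified role expressions are
   restricted. *)
Fixpoint wf_concept (NC NR : Type) (C : concept NC NR) : bool :=
  match C with
  | CName _ | Top | Bot => true
  | CNot D => wf_concept D
  | CAnd D E | COr D E => wf_concept D && wf_concept E
  | Ex U D | All U D => restricted U && wf_concept D
  | AtMost _ _ D => wf_concept D
  end.

Fixpoint nnf (NC NR : Type) (C : concept NC NR) : bool :=
  match C with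
  | CName _ | Top | Bot => true
  | CNot D => if D is CName _ then true else false
  | CAnd D E | COr D E => nnf D && nnf E
  | Ex _ D | All _ D | AtMost _ _ D => nnf D
  end.

Fixpoint number_free (NC NR : Type) (C : concept NC NR) : bool :=
  match C with
  | CName _ | Top | Bot => true
  | CNot D => number_free D
  | CAnd D E | COr D E => number_free D && number_free E
  | Ex _ D | All _ D => number_free D
  | AtMost _ _ _ => false
  end.


Definition func_role (NC NR : Type) (C : concept NC NR) : option (arole NR) :=
  match C with
  | AtMost 1 r Top => Some r
  | _ => None
  end.

Definition is_func (NC NR : Type) (C : concept NC NR) : bool :=
  isSome (func_role C).

Definition extended_ALCIFb (NC NR NI : Type) (K : kb NC NR NI) : bool :=
  all (fun C => [&& wf_concept C, nnf C & is_func C || number_free C]) (tbox K).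

(* No negation normal form here: the axioms (All R (not D)) or (All R D) added
   by [Ef] negate complex concepts D. *)
Definition extended_ALCIb (NC NR NI : Type) (K : kb NC NR NI) : bool :=
  all (fun C => wf_concept C && number_free C) (tbox K).

Record interp (NC NR NI : Type) : Type := Interp {
  dom : Type;
  dom_nonempty : [set: dom] !=set0;
  ind_int : NI -> dom;
  cname_int : NC -> set dom;
  rname_int : NR -> set (dom * dom)
}.


Definition arole_int (NC NR NI : Type) (I : interp NC NR NI) (r : arole NR) :
    set (dom I * dom I) :=
  match r with
  | Dir R => rname_int I R
  | Inv R => [set p | rname_int I R (p.2, p.1)]
  end.

Fixpoint brole_int (NC NR NI : Type) (I : interp NC NR NI) (U : brole NR) :
    set (dom I * dom I) :=
  match U with
  | RAt r => arole_int I r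
  | RNot V => ~` brole_int I V
  | RAnd V W => brole_int I V `&` brole_int I W
  | ROr V W => brole_int I V `|` brole_int I W
  end.

Fixpoint concept_int (NC NR NI : Type) (I : interp NC NR NI)
    (C : concept NC NR) : set (dom I) :=
  match C with
  | CName A => cname_int I A
  | Top => setT
  | Bot => set0
  | CNot D => ~` concept_int I D
  | CAnd D E => concept_int I D `&` concept_int I E
  | COr D E => concept_int I D `|` concept_int I E
  | Ex U D =>
      [set x | exists y, brole_int I U (x, y) /\ concept_int I D y]
  | All U D =>
      [set x | forall y, brole_int I U (x, y) -> concept_int I D y]
  | AtMost n r D =>
      [set x | [set y | arole_int I r (x, y) /\ concept_int I D y] #<= `I_n]
  end.

Definition term_int (NC NR NI : Type) (I : interp NC NR NI)
    (Z : nat -> dom I) (t : term NI) : dom I :=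
  match t with
  | Var x => Z x
  | Ind a => ind_int I a
  end.

Definition atom_sat (NC NR NI : Type) (I : interp NC NR NI)
    (Z : nat -> dom I) (F : atom NC NR NI) : Prop :=
  match F with
  | ConceptAtom A t => cname_int I A (term_int I Z t)
  | RoleAtom R t u => rname_int I R (term_int I Z t, term_int I Z u)
  | EqAtom t u => term_int I Z t = term_int I Z u
  end.

Definition body_sat (NC NR NI : Type) (I : interp NC NR NI)
    (Z : nat -> dom I) (B : seq (atom NC NR NI)) : Prop :=
  forall F, List.In F B -> atom_sat I Z F.

(* Unlike an empty body, an empty head is false. *)
Definition head_sat (NC NR NI : Type) (I : interp NC NR NI)
    (Z : nat -> dom I) (H : seq (atom NC NR NI)) : Prop :=
  H <> [::] /\ forall F, List.In F H -> atom_sat I Z F.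

Definition rule_sat (NC NR NI : Type) (I : interp NC NR NI)
    (r : rule NC NR NI) : Prop :=
  forall Z : nat -> dom I, (forall x, range (ind_int I) (Z x)) ->
    body_sat I Z (body r) -> head_sat I Z (head r).

Definition is_model (NC NR NI : Type) (I : interp NC NR NI)
    (K : kb NC NR NI) : Prop :=
  (forall C, List.In C (tbox K) -> concept_int I C = setT) /\
  (forall r, List.In r (rbox K) -> rule_sat I r).

Definition satisfiable (NC NR NI : Type) (K : kb NC NR NI) : Prop :=
  exists I : interp NC NR NI, is_model I K.

Definition equisatisfiable (NC NR NI : Type) (K1 K2 : kb NC NR NI) : Prop :=
  satisfiable K1 <-> satisfiable K2.

Fixpoint parts (NC NR : Type) (C : concept NC NR) : seq (concept NC NR) :=
  match C with
  | CName _ | Top | Bot => [:: C]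
  | CNot D => parts D
  | CAnd D E | COr D E => parts D ++ parts E
  | Ex _ D | All _ D | AtMost _ _ D => C :: parts D
  end.

Definition star (NC NR NI : Type) (K : kb NC NR NI) : kb NC NR NI :=
  KB [seq C <- tbox K | ~~ is_func C] (rbox K).

Definition kb_parts (NC NR NI : Type) (K : kb NC NR NI) : seq (concept NC NR) :=
  flatten [seq parts C | C <- tbox K].

Definition func_roles (NC NR NI : Type) (K : kb NC NR NI) : seq (arole NR) :=
  pmap (@func_role NC NR) (tbox K).

Definition arole_name (NR : Type) (r : arole NR) : NR :=
  match r with Dir R | Inv R => R end.

Fixpoint brole_names (NR : Type) (U : brole NR) : seq NR :=
  match U with
  | RAt r => [:: arole_name r]
  | RNot V => brole_names V
  | RAnd V W | ROr V W => brole_names V ++ brole_names W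
  end.

Fixpoint concept_rnames (NC NR : Type) (C : concept NC NR) : seq NR :=
  match C with
  | CName _ | Top | Bot => [::]
  | CNot D => concept_rnames D
  | CAnd D E | COr D E => concept_rnames D ++ concept_rnames E
  | Ex U D | All U D => brole_names U ++ concept_rnames D
  | AtMost _ r D => arole_name r :: concept_rnames D
  end.

Definition atom_rnames (NC NR NI : Type) (F : atom NC NR NI) : seq NR :=
  if F is RoleAtom R _ _ then [:: R] else [::].

Definition rule_rnames (NC NR NI : Type) (r : rule NC NR NI) : seq NR :=
  flatten [seq atom_rnames F | F <- body r ++ head r].

Definition kb_rnames (NC NR NI : Type) (K : kb NC NR NI) : seq NR :=
  flatten [seq concept_rnames C | C <- tbox K] ++
  flatten [seq rule_rnames r | r <- rbox K].

Definition kb_aroles (NC NR NI : Type) (K : kb NC NR NI) : seq (arole NR) :=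
  [seq Dir R | R <- kb_rnames K] ++ [seq Inv R | R <- kb_rnames K].

Definition ef_part_axiom (NC NR : Type) (r : arole NR) (D : concept NC NR) :
    concept NC NR :=
  COr (All (RAt r) (CNot D)) (All (RAt r) D).

Definition ef_role_axiom (NC NR : Type) (r s : arole NR) : concept NC NR :=
  COr (All (RAnd (RAt r) (RAt s)) Bot) (All (RAnd (RAt r) (RNot (RAt s))) Bot).

Definition ef_rule (NC NR NI : Type) (r : arole NR) : rule NC NR NI :=
  Rule [:: arole_atom NC r (Var 0) (Var 1); arole_atom NC r (Var 0) (Var 2)]
       [:: EqAtom (Var 1) (Var 2)].

Definition Ef (NC NR NI : Type) (K : kb NC NR NI) : kb NC NR NI :=
  KB (tbox (star K) ++
      flatten [seq [seq ef_part_axiom r D | D <- kb_parts (star K)] ++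
                   [seq ef_role_axiom NC r s | s <- kb_aroles K]
              | r <- func_roles K])
     (rbox K ++ [seq ef_rule NC NI r | r <- func_roles K]).

(* Main.v *)
Require Import Defs.
From Stdlib Require Import List ClassicalEpsilon.
From mathcomp Require Import all_boot.
From mathcomp Require Import boolp classical_sets functions cardinality.

(** If K has a model, each element has at most one R-successor for each
    functional R, so the axioms of Ef(K) hold in it.  Conversely, let I be a
    model of Ef(K).  Call two neighbours of x similar when they are equal or
    both R-successors of x for some functional R.  The axioms of Ef(K) make
    this an equivalence relation, and similar neighbours of x agree on all
    parts of axioms and on the roles of K that relate them to x.  Unravel I
    into a forest whose roots include the named individuals, keeping the
    relations between the latter, and give a node a child only for one
    representative of each similarity class that contains neither its parent
    nor (for a named individual) a named individual.  Then functionality holds,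
    and no class of potential witnesses for a quantifier is lost;
    restrictedness of the quantified role expressions ensures that unrelated
    nodes do not matter. *)

Set Implicit Arguments.
Unset Strict Implicit.
Unset Printing Implicit Defensive.

Local Open Scope classical_set_scope.
Local Open Scope card_scope.

(** * Cardinality and membership in lists of axioms and roles *)

Lemma card_le_I1P (T : Type) (A : set T) :
  A #<= `I_1 <-> (forall y z, A y -> A z -> y = z).
Proof.
rewrite II1; split=> [/pcard_leP[f] y z Ay Az | A1].
  have f0 t (At : A t) : f t = 0 by exact: (@funS _ _ A [set 0] f t At).
  by apply: (@inj _ _ A f); rewrite ?inE //; rewrite [LHS]f0 // [RHS]f0.
have [->|/set0P[y Ay]] := eqVneq A set0; first exact: card_ge0.
have -> : A = [set y] by apply/seteqP; split=> [z Az|_ ->] //; exact: A1.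
by rewrite (card_le_eql card_set1) -II1 card_lexx.
Qed.

Lemma allInP (T : Type) (a : pred T) (s : seq T) :
  all a s <-> (forall x, In x s -> a x).
Proof.
elim: s => [|x s IHs] //=; split.
  by case/andP=> ax /IHs as_ y [<-|/as_].
move=> as_; apply/andP; split; first by apply: as_; left.
by apply/IHs=> y ys; apply: as_; right.
Qed.

Lemma In_flatten_map (S T : Type) (f : S -> seq T) (s : seq S) (y : T) :
  In y (flatten [seq f x | x <- s]) <-> exists x, In x s /\ In y (f x).
Proof. by rewrite -in_flat_map flat_map_concat_map. Qed.

Lemma func_roleP (NC NR : Type) (C : concept NC NR) (r : arole NR) :
  func_role C = Some r -> C = AtMost 1 r Top.
Proof. by case: C => // [] [|[|n]] s [] //= [->]. Qed.

Lemma In_func_roles (NC NR NI : Type) (K : kb NC NR NI) (r : arole NR) :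
  In r (func_roles K) <-> In (AtMost 1 r Top) (tbox K).
Proof.
rewrite /func_roles; elim: (tbox K) => [|C s IHs] //=.
case CE: (func_role C) => [t|] /=.
  have -> := func_roleP CE; rewrite IHs.
  by split=> [[->|]|[[->]|]]; [left|right|left|right].
by rewrite IHs; split=> [|[CE'|//]]; [right | rewrite CE' in CE].
Qed.

Lemma In_func_roles_kb_rnames (NC NR NI : Type) (K : kb NC NR NI)
    (r : arole NR) :
  In r (func_roles K) -> In (arole_name r) (kb_rnames K).
Proof.
move=> /In_func_roles rK; apply/in_app_iff; left.
by apply/In_flatten_map; exists (AtMost 1 r Top); split=> //; left.
Qed.

Lemma In_kb_aroles (NC NR NI : Type) (K : kb NC NR NI) (s : arole NR) :
  In s (kb_aroles K) <-> In (arole_name s) (kb_rnames K).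
Proof.
rewrite in_app_iff !in_map_iff; case: s => R /=; split.
- by case=> [[S [[<-]]]|[S []]].
- by move=> RK; left; exists R.
- by case=> [[S []]|[S [[<-]]]].
- by move=> RK; right; exists R.
Qed.

(** * Syntax of the axioms of [Ef K] *)

Definition plain (NC NR : Type) (C : concept NC NR) : bool :=
  wf_concept C && number_free C.

Lemma plain_parts (NC NR : Type) (C D : concept NC NR) :
  plain C -> In D (parts C) -> plain D.
Proof.
rewrite /plain; elim: C => //=.
- by move=> A _ [<-|].
- by move=> _ [<-|].
- by move=> _ [<-|].
1,2: move=> E IHE F IHF /andP[/andP[wE wF] /andP[nE nF]] /in_app_iff[];
  by [apply: IHE; rewrite wE | apply: IHF; rewrite wF].
1,2: move=> U E IHE /andP[/andP[rU wE] nE] [<-/=|];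
  by [rewrite rU wE | apply: IHE; rewrite wE].
- by move=> n r E _ /andP[].
Qed.

Lemma star_plain (NC NR NI : Type) (K : kb NC NR NI) (C : concept NC NR) :
  extended_ALCIFb K -> In C (tbox (star K)) -> plain C.
Proof.
move=> /allInP hK /filter_In[/hK/and3P[wC _ fC] nfC].
by rewrite /plain wC /=; case/orP: fC => // fC; rewrite fC in nfC.
Qed.

Lemma In_kb_parts_star (NC NR NI : Type) (K : kb NC NR NI)
    (C D : concept NC NR) :
  In C (tbox (star K)) -> In D (parts C) -> In D (kb_parts (star K)).
Proof. by move=> CK DC; apply/In_flatten_map; exists C. Qed.

Lemma In_tbox_Ef (NC NR NI : Type) (K : kb NC NR NI) (C : concept NC NR) :
  In C (tbox (Ef K)) <->
  [\/ In C (tbox (star K)),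
      exists r D, [/\ In r (func_roles K), In D (kb_parts (star K)) &
                      C = ef_part_axiom r D]
    | exists r s, [/\ In r (func_roles K), In s (kb_aroles K) &
                      C = ef_role_axiom NC r s]].
Proof.
rewrite in_app_iff In_flatten_map; split.
  case=> [CK|[r [rK /in_app_iff[]/in_map_iff[D [<- DK]]]]].
  - exact: Or31.
  - by apply: Or32; exists r, D.
  - by apply: Or33; exists r, D.
case=> [CK|[r [D [rK DK ->]]]|[r [D [rK DK ->]]]]; first by left.
- right; exists r; split=> //; apply/in_app_iff; left; exact: in_map.
- right; exists r; split=> //; apply/in_app_iff; right.
  exact: (in_map (ef_role_axiom NC r)).
Qed.

(** In the role axioms restrictedness holds by computation: the positive conjunct [RAt r] fails at
    the empty set, whatever the negated one does. *)
Lemma Ef_ALCIb (NC NR NI : Type) (K : kb NC NR NI) :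
  extended_ALCIFb K -> extended_ALCIb (Ef K).
Proof.
move=> hK; apply/allInP=> C /In_tbox_Ef[|[r [D [_ DK ->]]]|[r [s [_ _ ->]]] //].
  exact: star_plain.
have /In_flatten_map[E [EK DE]] := DK.
have /andP[wD nD] := plain_parts (star_plain hK EK) DE.
by rewrite /= wD nD.
Qed.

(** * Models of [K] are models of [Ef K] *)

Lemma arole_atom_sat (NC NR NI : Type) (I : interp NC NR NI) (Z : nat -> dom I)
    (r : arole NR) (t u : term NI) :
  atom_sat I Z (arole_atom NC r t u) <->
  arole_int I r (term_int I Z t, term_int I Z u).
Proof. by case: r. Qed.

Lemma ef_rule_sat (NC NR NI : Type) (I : interp NC NR NI) (r : arole NR) :
  rule_sat I (ef_rule NC NI r) <->
  (forall x y z, range (ind_int I) x -> range (ind_int I) y ->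
     range (ind_int I) z ->
     arole_int I r (x, y) -> arole_int I r (x, z) -> y = z).
Proof.
split=> [rI x y z xI yI zI rxy rxz | rI Z ZI bZ].
  (* Variables beyond 2 do not occur in the rule; they get [z] because every variable must denote a
     named element. *)
  pose Z n := if n is n'.+1 then if n' is 0 then y else z else x.
  have [] := rI Z; first by case=> [|[|n]].
    by move=> F /= [<-|[<-|//]]; apply/arole_atom_sat.
  by move=> _ /(_ _ (or_introl erefl)).
split=> // F [<-|//] /=.
apply: (rI (Z 0)); rewrite ?ZI //.
  by apply/(arole_atom_sat Z r (Var 0) (Var 1)); apply: bZ; left.
by apply/(arole_atom_sat Z r (Var 0) (Var 2)); apply: bZ; right; left.
Qed.

Lemma model_Ef (NC NR NI : Type) (K : kb NC NR NI) (I : interp NC NR NI) :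
  is_model I K -> is_model I (Ef K).
Proof.
move=> [tI rI].
have fI r x y z : In r (func_roles K) ->
    arole_int I r (x, y) -> arole_int I r (x, z) -> y = z.
  move=> /In_func_roles/tI /seteqP[_ /(_ x Logic.I)] /card_le_I1P fx rxy rxz.
  exact: fx.
split=> [C /In_tbox_Ef[/filter_In[CK _]||]|r /in_app_iff[/rI//|]].
- exact: tI.
- move=> [r [D [rK _ ->]]]; apply/seteqP; split=> // x _.
  (* An [r]-successor in [D] is the only [r]-successor, so one of the two disjuncts always holds. *)
  have [[y [rxy Dy]]|nD] := pselect (exists y, arole_int I r (x, y) /\
    concept_int I D y).
    by right=> z rxz; rewrite (fI _ _ _ _ rK rxz rxy).
  by left=> y rxy Dy; apply: nD; exists y.
- move=> [r [s [rK _ ->]]]; apply/seteqP; split=> // x _.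
  have [[y [rxy sxy]]|ns] := pselect (exists y, arole_int I r (x, y) /\
    arole_int I s (x, y)).
    by right=> z [rxz nsxz]; apply: nsxz; rewrite (fI _ _ _ _ rK rxz rxy).
  by left=> y [rxy sxy]; apply: ns; exists y.
- move=> /in_map_iff[s [<- sK]]; apply/ef_rule_sat=> x y z _ _ _.
  exact: fI.
Qed.

(** * What the meaning of concepts and role expressions depends on *)

Lemma concept_int_parts (NC NR NI : Type) (I : interp NC NR NI)
    (C : concept NC NR) (y z : dom I) :
  (forall D, In D (parts C) -> concept_int I D y <-> concept_int I D z) ->
  concept_int I C y <-> concept_int I C z.
Proof.
elim: C => //=.
- by move=> A /(_ _ (or_introl erefl)).
- by move=> D IHD /IHD ->.
- move=> D IHD E IHE h; rewrite /setI /= IHD ?IHE // => F FD;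
    by apply: h; apply/in_app_iff; auto.
- move=> D IHD E IHE h; rewrite /setU /= IHD ?IHE // => F FD;
    by apply: h; apply/in_app_iff; auto.
(* A quantified concept is a part of itself: [C] is a Boolean combination of its parts, and the
   induction stops here. *)
- by move=> U D _ /(_ _ (or_introl erefl)).
- by move=> U D _ /(_ _ (or_introl erefl)).
- by move=> n r D _ /(_ _ (or_introl erefl)).
Qed.

Lemma brole_int_eq (NC NR NI : Type) (I J : interp NC NR NI)
    (U : brole NR) (p : dom I * dom I) (q : dom J * dom J) :
  (forall r, In (arole_name r) (brole_names U) ->
     arole_int I r p <-> arole_int J r q) ->
  brole_int I U p <-> brole_int J U q.
Proof.
elim: U => [r|V IHV|V IHV W IHW|V IHV W IHW] /=.
- by apply; left.
- by move=> /IHV; rewrite /setC /= => ->.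
- move=> h; rewrite /setI /= IHV ?IHW // => r rU;
    by apply: h; apply/in_app_iff; auto.
- move=> h; rewrite /setU /= IHV ?IHW // => r rU;
    by apply: h; apply/in_app_iff; auto.
Qed.

Lemma brole_int_unrelated (NC NR NI : Type) (I : interp NC NR NI)
    (U : brole NR) (p : dom I * dom I) :
  (forall r, ~ arole_int I r p) -> brole_int I U p <-> entails pred0 U.
Proof.
move=> np; elim: U => [r|V IHV|V IHV W IHW|V IHV W IHW] /=.
- by split=> // /np.
- by rewrite /setC /= IHV; split=> /negP.
- by rewrite /setI /= IHV IHW; split=> /andP.
- by rewrite /setU /= IHV IHW; split=> /orP.
Qed.

(** * The unravelling *)

Section Unravelling.

Variables (NC NR NI : Type) (K : kb NC NR NI) (I : interp NC NR NI).

Implicit Types (r : arole NR) (x y z : dom I).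

Definition similar x y z : Prop :=
  y = z \/ exists r,
    [/\ In r (func_roles K), arole_int I r (x, y) & arole_int I r (x, z)].

(** Similar elements have the same class as a predicate, so [epsilon] picks the same element for
    them. The default [x] is never reached, since [y] is similar to itself. *)
Definition repr x y : dom I := epsilon (inhabits x) (similar x y).

Definition named x : Prop := range (ind_int I) x.

(* The node [(x, s)] stands for the path [rev (x :: s)]; [fresh s x y] says
   that it has a child ending in [y]. Paths taking a step that is not fresh are
   harmless: they start a new tree. *)
Fixpoint fresh (s : seq (dom I)) x y : Prop :=
  repr x y = y /\
  match s with
  | [::] => ~ (named x /\ exists2 z, named z & similar x z y)
  | z :: s' => ~ (fresh s' z x /\ similar x z y)
  end.

Definition node : Type := (dom I * seq (dom I))%type.

Implicit Types p q : node.

Definition child p q : Prop := q.2 = p.1 :: p.2 /\ fresh p.2 p.1 q.1.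

(** Symmetric, so that inverse roles are treated like role names. The last case includes [p = q],
    which keeps the loops of [I] at named elements. *)
Definition adjacent p q : Prop :=
  [\/ child p q, child q p |
      [/\ p.2 = [::], q.2 = [::], named p.1 & named q.1]].

Lemma adjacentC p q : adjacent p q -> adjacent q p.
Proof.
by case=> [|| []]; [apply: Or32 | apply: Or31 | move=> *; apply: Or33].
Qed.

Lemma node_nonempty : [set: node] !=set0.
Proof. by have [x _] := dom_nonempty I; exists (x, [::]). Qed.

Definition unravelling : interp NC NR NI :=
  @Interp NC NR NI node node_nonempty (fun a => (ind_int I a, [::]))
    (fun A => [set p | cname_int I A p.1])
    (fun R => [set pq | adjacent pq.1 pq.2 /\
                        rname_int I R (pq.1.1, pq.2.1)]).

Lemma arole_int_unravelling r p q :
  arole_int unravelling r (p, q) <->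
  adjacent p q /\ arole_int I r (p.1, q.1).
Proof. by case: r => R //=; split=> -[/adjacentC]. Qed.

(** Non-adjacent nodes satisfy no atomic role, so there [U] takes its value at the empty set, which
    is false; adjacent nodes satisfy the same atomic roles as their endpoints. *)
Lemma brole_int_unravelling (U : brole NR) p q :
  restricted U ->
  brole_int unravelling U (p, q) <-> adjacent p q /\ brole_int I U (p.1, q.1).
Proof.
move=> rU; have [apq|napq] := pselect (adjacent p q).
  rewrite (@brole_int_eq _ _ _ _ I _ _ (p.1, q.1)); first by split=> // -[].
  by move=> r _; rewrite arole_int_unravelling; split=> // -[].
rewrite brole_int_unrelated; first by split=> [|[]//]; rewrite (negPf rU).
by move=> r /arole_int_unravelling[].
Qed.

(** * Similarity as an equivalence respecting roles and parts *)

Hypothesis IE : is_model I (Ef K).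

Lemma func_role_agree r s x y z : In r (func_roles K) ->
  In (arole_name s) (kb_rnames K) ->
  arole_int I r (x, y) -> arole_int I r (x, z) ->
  arole_int I s (x, y) -> arole_int I s (x, z).
Proof.
move=> rK /In_kb_aroles sK rxy rxz sxy.
have /IE.1/seteqP[_ /(_ x Logic.I)] : In (ef_role_axiom NC r s) (tbox (Ef K)).
  by apply/In_tbox_Ef/Or33; exists r, s.
case=> [/(_ y)[]//|h]; apply: contrapT => nsxz; exact: (h z).
Qed.

Lemma func_part_agree r (D : concept NC NR) x y z : In r (func_roles K) ->
  In D (kb_parts (star K)) ->
  arole_int I r (x, y) -> arole_int I r (x, z) ->
  concept_int I D y -> concept_int I D z.
Proof.
move=> rK DK rxy rxz Dy.
have /IE.1/seteqP[_ /(_ x Logic.I)] : In (ef_part_axiom r D) (tbox (Ef K)).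
  by apply/In_tbox_Ef/Or32; exists r, D.
by case=> /= [/(_ y rxy)//|]; apply.
Qed.

Lemma similar_sym x y z : similar x y z -> similar x z y.
Proof. by case=> [->|[r []]]; [left | right; exists r]. Qed.

Lemma similar_trans x y z t : similar x y z -> similar x z t -> similar x y t.
Proof.
case=> [->//|[r [rK rxy rxz]]] [<-|[s [sK sxz sxt]]]; right; first by exists r.
(* The role axiom for [r] and [s] carries [s] from [z] to [y], so [s] alone links [y] to [t]. *)
exists s; split=> //; apply: func_role_agree rK _ rxz rxy sxz.
exact: In_func_roles_kb_rnames.
Qed.

Lemma similar_role s x y z : similar x y z ->
  In (arole_name s) (kb_rnames K) ->
  arole_int I s (x, y) <-> arole_int I s (x, z).
Proof.
case=> [->|[r [rK rxy rxz]]] sK; first by split.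
split; [exact: func_role_agree rxy rxz | exact: func_role_agree rxz rxy].
Qed.

Lemma similar_brole (U : brole NR) x y z : similar x y z ->
  (forall R, In R (brole_names U) -> In R (kb_rnames K)) ->
  brole_int I U (x, y) <-> brole_int I U (x, z).
Proof.
by move=> yz UK; apply: brole_int_eq => r /UK; exact: similar_role.
Qed.

Lemma similar_concept (C : concept NC NR) x y z : similar x y z ->
  (forall D, In D (parts C) -> In D (kb_parts (star K))) ->
  concept_int I C y <-> concept_int I C z.
Proof.
case=> [->|[r [rK rxy rxz]]] CK; first by split.
apply: concept_int_parts => E /CK EK.
split; [exact: func_part_agree rxy rxz | exact: func_part_agree rxz rxy].
Qed.

Lemma repr_similar x y : similar x y (repr x y).
Proof. by apply: epsilon_spec; exists y; left. Qed.

Lemma eq_repr x y z : similar x y z -> repr x y = repr x z.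
Proof.
move=> yz; congr epsilon; apply/funext=> t; apply/propext.
by split; apply: similar_trans; [exact: similar_sym | ].
Qed.

(** * Neighbours in the unravelling: existence and uniqueness *)

Lemma adjacent_similar p y : exists2 q, adjacent p q & similar p.1 y q.1.
Proof.
case: p => x s /=; have yy' := repr_similar x y.
set y' := repr x y in yy'.
have y'K : repr x y' = y' by rewrite -(eq_repr yy').
have [fr|nfr] := pselect (fresh s x y').
  by exists (y', x :: s) => //; apply: Or31.
have back z : similar x z y' -> similar x y z.
  by move=> /similar_sym; apply: similar_trans.
(* As [y'] is a representative, only the second clause of [fresh] can fail, and its failure yields a
   named root or the parent as the required neighbour. *)
case: s nfr => [|z s] /= /not_andP[//|/contrapT].
  by case=> nx [z nz /back]; exists (z, [::]) => //; apply: Or33.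
by case=> fr /back; exists (z, s) => //; apply: Or32.
Qed.

Lemma adjacent_similar_uniq p q q' r : In r (func_roles K) ->
  adjacent p q -> adjacent p q' ->
  arole_int I r (p.1, q.1) -> arole_int I r (p.1, q'.1) -> q = q'.
Proof.
case: p q q' => x s [y t] [y' t'] rK aq aq' /= rxy rxy'.
have yy' : similar x y y' by right; exists r.
have y'y := similar_sym yy'.
have reprK s0 z : fresh s0 x z -> repr x z = z by case: s0 => [|? ?] [].
(* Two children end in the same representative, two parents coincide, and two named roots are
   identified by the rule for [r]. A child beside a parent or a named root contradicts freshness; a
   node with a parent is not a root. *)
case: aq => [[/= tE fr]|[/= sE fr]|[/= sE tE nx ny]];
  case: aq' => [[/= tE' fr']|[/= sE' fr']|[/= sE' tE' nx' ny']].
- by rewrite tE tE' -(reprK _ _ fr) -(reprK _ _ fr') (eq_repr yy').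
- by rewrite sE' /= in fr; case: fr => _ [].
- by rewrite sE' /= in fr; case: fr => _ []; split=> //; exists y'.
- by rewrite sE /= in fr'; case: fr' => _ [].
- by move: sE'; rewrite sE => -[-> ->].
- by rewrite sE in sE'.
- by rewrite sE /= in fr'; case: fr' => _ []; split=> //; exists y.
- by rewrite sE in sE'.
- have /IE.2/ef_rule_sat rI : In (ef_rule NC NI r) (rbox (Ef K)).
    by apply/in_app_iff; right; apply: in_map.
  by rewrite tE tE' (rI _ _ _ nx ny ny' rxy rxy').
Qed.

(** * Transfer of concepts and rules to the unravelling *)

Lemma concept_int_unravelling (C : concept NC NR) p :
  plain C ->
  (forall D, In D (parts C) -> In D (kb_parts (star K))) ->
  (forall R, In R (concept_rnames C) -> In R (kb_rnames K)) ->
  concept_int unravelling C p <-> concept_int I C p.1.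
Proof.
rewrite /plain; elim: C p => //=.
- by move=> D IHD p wD pD rD; rewrite /setC /= IHD.
- move=> D IHD E IHE p /andP[/andP[wD wE] /andP[nD nE]] pK rK.
  by rewrite /setI /= IHD ?IHE ?wD ?wE // => F FK;
    [apply: pK|apply: rK|apply: pK|apply: rK]; apply/in_app_iff; auto.
- move=> D IHD E IHE p /andP[/andP[wD wE] /andP[nD nE]] pK rK.
  by rewrite /setU /= IHD ?IHE ?wD ?wE // => F FK;
    [apply: pK|apply: rK|apply: pK|apply: rK]; apply/in_app_iff; auto.
- move=> U D IHD p /andP[/andP[rU wD] nD] pK rK.
  have UK R : In R (brole_names U) -> In R (kb_rnames K).
    by move=> RU; apply: rK; apply/in_app_iff; left.
  have pD E : In E (parts D) -> In E (kb_parts (star K)) by auto.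
  have {}IHD q : concept_int unravelling D q <-> concept_int I D q.1.
    by apply: IHD; rewrite ?wD // => R RD; apply: rK; apply/in_app_iff; right.
  split=> [[q []]|[y [Uxy Dy]]].
    by move=> /(brole_int_unravelling _ _ rU)[_ Upq] /IHD Dq; exists q.1.
  (* No neighbour of [p] need end in [y] itself; a similar endpoint serves, since similarity
     preserves both [U] and [D]. *)
  have [q apq yq] := adjacent_similar p y; exists q; split.
    apply/(brole_int_unravelling _ _ rU); split=> //.
    by apply/(similar_brole yq UK).
  by apply/IHD/(similar_concept yq pD).
- move=> U D IHD p /andP[/andP[rU wD] nD] pK rK.
  have UK R : In R (brole_names U) -> In R (kb_rnames K).
    by move=> RU; apply: rK; apply/in_app_iff; left.
  have pD E : In E (parts D) -> In E (kb_parts (star K)) by auto.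
  have {}IHD q : concept_int unravelling D q <-> concept_int I D q.1.
    by apply: IHD; rewrite ?wD // => R RD; apply: rK; apply/in_app_iff; right.
  split=> [Up y Uxy|Up q /(brole_int_unravelling _ _ rU)[_ Upq]].
    have [q apq yq] := adjacent_similar p y.
    apply/(similar_concept yq pD)/IHD/Up.
    apply/(brole_int_unravelling _ _ rU); split=> //.
    by apply/(similar_brole yq UK).
  exact/IHD/Up.
- by move=> n r D _ p /andP[].
Qed.

(** By DL-safety, all terms denote named roots, on which the unravelling copies concept names, roles
    and equality from [I]. *)
Lemma rule_sat_unravelling (rl : rule NC NR NI) :
  rule_sat I rl -> rule_sat unravelling rl.
Proof.
move=> rI Z ZJ; pose Z' n := (Z n).1.
have ZE n : Z n = (Z' n, [::]) by have [a _ aE] := ZJ n; rewrite /Z' -aE.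
have Z'I n : named (Z' n).
  by have [a _ aE] := ZJ n; exists a => //; rewrite /Z' -aE.
have tE (t : term NI) :
    term_int unravelling Z t = (term_int I Z' t, [::]).
  by case: t => [n|a] //=; rewrite ZE.
have tN (t : term NI) : named (term_int I Z' t).
  by case: t => [n|a] //=; exists a.
have FE F : atom_sat unravelling Z F <-> atom_sat I Z' F.
  case: F => [A t|R t u|t u] /=; rewrite !tE /=; first by split.
    by split=> [[]//|Rtu]; split=> //; apply: Or33; split=> //=.
  by split=> [[]|->].
move=> bZ; have [|hN hZ] := rI Z' Z'I; first by move=> F /bZ/FE.
by split=> // F /hZ/FE.
Qed.

Lemma unravelling_model : extended_ALCIFb K -> is_model unravelling K.
Proof.
move=> hK; split=> [C CK|rl rlK]; last first.
  by apply: rule_sat_unravelling; apply: IE.2; apply/in_app_iff; left.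
apply/seteqP; split=> // p _.
case CE: (func_role C) => [r|].
  have CE' := func_roleP CE; rewrite CE' in CK *.
  have rK : In r (func_roles K) by apply/In_func_roles.
  apply/card_le_I1P=> q q' [/arole_int_unravelling[aq rq] _].
  move=> [/arole_int_unravelling[aq' rq'] _].
  exact: adjacent_similar_uniq rK aq aq' rq rq'.
have CK' : In C (tbox (star K)).
  by apply/filter_In; rewrite /is_func CE.
apply/concept_int_unravelling.
- exact: star_plain CK'.
- by move=> D; apply: In_kb_parts_star.
- move=> R RC; apply/in_app_iff; left; apply/In_flatten_map.
  by exists C.
- by rewrite IE.1 //; apply/In_tbox_Ef/Or31.
Qed.

End Unravelling.

Theorem theorem6p15 (NC NR NI : Type) (K : kb NC NR NI)
    (hK : extended_ALCIFb K) :
  extended_ALCIb (Ef K) /\ equisatisfiable (Ef K) K.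
Proof.
split; first exact: Ef_ALCIb.
split=> -[I mI]; last by exists I; apply: model_Ef.
by exists (unravelling K I); apply: unravelling_model.
Qed.
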